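(* Let $n\ge1$ be an integer. The functions $\mathsf{f}\colon \mathcal{B}_n^+\to\mathcal{P}_n$ (which negates every entry of $B\in\mathcal{B}_n^+$ whose index is not a peak of $B$) and $\mathsf{g}\colon\mathcal{P}_n\to\mathcal{B}_n^+$ (which negates every entry of $P\in\mathcal{P}_n$ whose index is not a pivot of $P$) are bijections and, in fact, inverses of each other.
   Context: Let $\mathcal{S}_n=\{s_1\cdots s_{2n} : s_i\in\{-1,+1\}\}$ be the set of $\pm1$ sequences of length $2n$. For $S=s_1\cdots s_{2n}\in\mathcal{S}_n$ put $\sigma_i(S)=\sum_{j=1}^i s_j$ for $1\le i\le 2n$, and $\sum S=\sigma_{2n}(S)$. $\mathcal{B}_n^+$ is the set of $B\in\mathcal{S}_n$ that are balanced, i.e. $\sum B=0$, and whose first entry is $+1$. $\mathcal{P}_n$ is the set of positive sequences, i.e. those $P\in\mathcal{S}_n$ with $\sigma_i(P)>0$ for all $1\le i\le 2n$. Peaks and $\mathsf{f}$: for $B\in\mathcal{B}_n^+$ let $t=\max_{1\le i\le 2n}\sigma_i(B)$, and for $1\le k\le t$ let $\pi_k=\min\{i : \sigma_i(B)=k\}$. The set of peaks of $B$ is $\pi(B)=\{\pi_1,\dots,\pi_t\}$. The sequence $\mathsf{f}(B)$ is defined by $\mathsf{f}(B)_i=B_i$ for $i\in\pi(B)$ and $\mathsf{f}(B)_i=-B_i$ for $i\in\{1,\dots,2n\}\setminus\pi(B)$. Pivots and $\mathsf{g}$: for $P\in\mathcal{P}_n$ let $T=\frac12\sum P$, let $\Pi_1=1$,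 and for $1<k\le T$ let $\Pi_k=1+\max\{j : \sigma_j(P)=k-1\}$. The set of pivots of $P$ is $\Pi(P)=\{\Pi_1,\dots,\Pi_T\}$. The sequence $\mathsf{g}(P)$ is defined by $\mathsf{g}(P)_j=P_j$ for $j\in\Pi(P)$ and $\mathsf{g}(P)_j=-P_j$ for $j\in\{1,\dots,2n\}\setminus\Pi(P)$. *)

(* Defs.v *)
From mathcomp Require Import all_boot all_order all_algebra.
From mathcomp Require Import classical_sets functions.

Set Implicit Arguments.
Unset Strict Implicit.
Unset Printing Implicit Defensive.

Import Order.TTheory GRing.Theory Num.Theory.
Local Open Scope classical_set_scope.
Local Open Scope ring_scope.

(* Positions are numbered 1, ..., 2n; the entry s_i of S = s_1 ... s_2n is
   stored at the ordinal of value i - 1. *)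
Definition intseq (n : nat) : Type := {ffun 'I_(n.*2) -> int}.

Definition sign_seqs (n : nat) : set (intseq n) :=
  [set S | forall i, S i = - 1 \/ S i = 1].

Definition psum (n : nat) (S : intseq n) (i : nat) : int :=
  \sum_(j < n.*2 | (j < i)%N) S j.

Definition total (n : nat) (S : intseq n) : int := psum S n.*2.

Definition balanced_pos (n : nat) : set (intseq n) :=
  [set B | [/\ sign_seqs B, total B = 0 &
               forall i : 'I_(n.*2), nat_of_ord i = 0%N -> B i = 1]].
Arguments balanced_pos n : clear implicits.

Definition positive_seqs (n : nat) : set (intseq n) :=
  [set P | sign_seqs P /\
           forall i : nat, (1 <= i <= n.*2)%N -> 0 < psum P i].
Arguments positive_seqs n : clear implicits.

(* The default values of the two iterated operators below are harmless when
   0 < n: psum B 1 is itself one of the partial sums, and n.*2 bounds every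
   position from above. *)
Definition max_psum (n : nat) (B : intseq n) : int :=
  \big[Order.max/psum B 1]_(1 <= i < n.*2.+1) psum B i.

Definition peak (n : nat) (B : intseq n) (k : nat) : nat :=
  \big[minn/n.*2]_(1 <= i < n.*2.+1 | psum B i == k%:Z) i.

(* For a sequence of signs max_psum B <= 2n, so letting k range over 1, ..., 2n
   loses no peak. *)
Definition peaks (n : nat) (B : intseq n) : seq nat :=
  [seq peak B k | k <- iota 1 n.*2 & k%:Z <= max_psum B].

Definition peak_flip (n : nat) (B : intseq n) : intseq n :=
  [ffun i : 'I_(n.*2) => if i.+1 \in peaks B then B i else - B i].

(* The sum of 2n signs is even, so this division is exact. *)
Definition half_total (n : nat) (P : intseq n) : int := (total P %/ 2)%Z.

Definition pivot (n : nat) (P : intseq n) (k : nat) : nat :=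
  if k == 1%N then 1%N
  else (1 + \max_(1 <= j < n.*2.+1 | (psum P j == k%:Z - 1)%R) j)%N.

(* For a sequence of signs half_total P <= n, so letting k range over 1, ..., n
   loses no pivot. *)
Definition pivots (n : nat) (P : intseq n) : seq nat :=
  [seq pivot P k | k <- iota 1 n & k%:Z <= half_total P].

Definition pivot_flip (n : nat) (P : intseq n) : intseq n :=
  [ffun j : 'I_(n.*2) => if j.+1 \in pivots P then P j else - P j].

(* Main.v *)
Require Import Defs.
From mathcomp Require Import all_boot all_order all_algebra.
From mathcomp Require Import classical_sets functions.
From mathcomp Require Import zify.

(** A peak and a pivot are two readings of one symmetric notion.  Let [D] be a
    set of positions and let [m i] count the elements of [D] among the first [i]
    positions; [m] is a staircase.  Say that [D] lies above a walk if the walk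
    steps up at each position of [D], starting from height exactly [m], and is
    nowhere higher than [m]; dually for below, where in addition the walk ends
    at height twice the final value of [m].

    - [D] lies above a sign sequence exactly when [D] is the set of positions
      where its walk sets a strict record; [m] is then the running maximum
      ([above_record], [above_unique]).  These positions are the peaks
      ([peaksE]).
    - [D] lies below a positive sequence exactly when [D] is the set of
      positions where its walk leaves for good a level smaller than half the
      total; [m] is then the least height still to come, cut off at half the
      total ([below_departure], [below_unique]).  These positions are the pivots
      ([pivotsE]).

    If the entries on [D] are 1, negating the other entries turns the partial
    sums [x i] into [2 m i - x i]: it reflects the walk in the staircase.  The
    reflection keeps the points where the walk touches the staircase and
    exchanges above and below, and total 0 corresponds to the total required
    below ([below_flip], [above_flip]).  So the peaks of a balanced [B] are the
    pivots of [peak_flip B], the pivots of a positive [P] are the peaks of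
    [pivot_flip P], and each map undoes the other because it negates the same
    entries again.  This is a discrete form of Pitman's transformation, which
    sends a walk [x] with running maximum [m] to [2 m - x]. *)

Section PeaksAndPivots.

Local Set Implicit Arguments.
Local Unset Strict Implicit.

Import Order.TTheory GRing.Theory Num.Theory.
(* Makes [total] the sum of all entries again, not totality of a relation. *)
Import Defs.
Local Open Scope ring_scope.

Variable n : nat.
Implicit Types (S B P : intseq n) (D : pred 'I_(n.*2)).

(** * Partial sums as walks *)

Lemma psum0 S : psum S 0 = 0.
Proof. by rewrite /psum big_pred0. Qed.

Lemma psumS S (i : 'I_(n.*2)) : psum S i.+1 = psum S i + S i.
Proof.
rewrite /psum (bigD1 i) ?ltnS //= addrC; congr (_ + _).
by apply: eq_bigl => j; rewrite ltnS ltn_neqAle andbC.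
Qed.

Lemma psum_le_step S i : sign_seqs S -> (i < n.*2)%N ->
  psum S i.+1 <= psum S i + 1.
Proof.
move=> sgnS lt_i; rewrite (psumS S (Ordinal lt_i)) /=.
by case: (sgnS (Ordinal lt_i)) => ->; lia.
Qed.

Lemma psum_le S i : sign_seqs S -> (i <= n.*2)%N -> psum S i <= i%:Z.
Proof.
move=> sgnS; elim: i => [|i IHi] le_i; first by rewrite psum0.
by have := psum_le_step sgnS le_i; have := IHi (ltnW le_i); lia.
Qed.

Lemma psum_parity S i : sign_seqs S -> (i <= n.*2)%N ->
  exists q : int, psum S i = 2 * q - i%:Z.
Proof.
move=> sgnS; elim: i => [|i IHi] le_i; first by exists 0; rewrite psum0.
have [q qE] := IHi (ltnW le_i); rewrite (psumS S (Ordinal le_i)) /= qE.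
by case: (sgnS (Ordinal le_i)) => ->; [exists q | exists (q + 1)]; lia.
Qed.

Lemma half_totalE S : sign_seqs S -> total S = 2 * half_total S.
Proof.
move=> sgnS; rewrite /half_total /total.
by have [q ->] := psum_parity sgnS (leqnn _); lia.
Qed.

(** Steps of a walk raise it by at most one, so no level is jumped over. *)
Lemma psum_hits S a b (k : int) : sign_seqs S -> (a <= b <= n.*2)%N ->
  psum S a <= k <= psum S b -> exists2 j, (a <= j <= b)%N & psum S j = k.
Proof.
move=> sgnS /andP[le_ab]; elim: b le_ab => [|b IHb] le_ab le_b le_k.
  by exists 0%N; [lia | move: le_k; (have -> : (a = 0)%N by lia); lia].
have [le_kb|lt_bk] := leP k (psum S b).
  have [eq_a|lt_ab] : a = b.+1 \/ (a <= b)%N by lia.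
    by exists a; [lia | move: le_k; rewrite eq_a; lia].
  by have [|j j_range jE] := IHb lt_ab (ltnW le_b); [lia | exists j; first lia].
by exists b.+1; [lia | have := psum_le_step sgnS le_b; lia].
Qed.

(** * Staircases above and below a walk *)

Definition marks D : intseq n := [ffun i => (D i : nat)%:Z].

Definition stair D : nat -> int := psum (marks D).

Lemma stair0 D : stair D 0 = 0.
Proof. exact: psum0. Qed.

Lemma stairS D (i : 'I_(n.*2)) : stair D i.+1 = stair D i + (D i : nat)%:Z.
Proof. by rewrite /stair psumS ffunE. Qed.

Lemma stair_le D i j : (i <= j <= n.*2)%N -> stair D i <= stair D j.
Proof.
move=> /andP[]; elim: j => [|j IHj] le_ij le_j; first by have -> : (i = 0)%N by lia.
have [->//|lt_ij] : i = j.+1 \/ (i <= j)%N by lia.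
by have := IHj lt_ij (ltnW le_j); rewrite (stairS D (Ordinal le_j)) /=; lia.
Qed.

Definition climbs D S :=
  forall i : 'I_(n.*2), D i -> S i = 1 /\ psum S i = stair D i.

Definition above D S :=
  climbs D S /\ forall i, (i <= n.*2)%N -> psum S i <= stair D i.

Definition below D S :=
  [/\ climbs D S, forall i, (i <= n.*2)%N -> stair D i <= psum S i &
      total S = 2 * stair D n.*2].

Definition record S : pred 'I_(n.*2) := fun i =>
  [forall j : 'I_(n.*2), (j <= i)%N ==> (psum S j < psum S i.+1)].

(** Comparing twice the height with the total avoids a division: the walk
    leaves, for good, a level smaller than half its total. *)
Definition departure S : pred 'I_(n.*2) := fun i =>
  (2 * psum S i < total S) &&
  [forall j : 'I_(n.*2), (i <= j)%N ==> (psum S i < psum S j.+1)].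

Lemma recordP S (i : 'I_(n.*2)) :
  reflect (forall j, (j <= i)%N -> psum S j < psum S i.+1) (record S i).
Proof.
apply: (iffP forallP) => [H j le_ji | H j]; last by apply/implyP/H.
have lt_j : (j < n.*2)%N by have := ltn_ord i; lia.
by have /implyP := H (Ordinal lt_j); apply.
Qed.

Lemma departureP S (i : 'I_(n.*2)) :
  reflect (2 * psum S i < total S /\
           forall j, (i < j <= n.*2)%N -> psum S i < psum S j)
          (departure S i).
Proof.
apply: (iffP andP) => -[lt_tot H]; split=> //.
  case=> [|j] // /andP[le_ij lt_j].
  by have /implyP := forallP H (Ordinal lt_j); apply.
apply/forallP => j; apply/implyP => le_ij; apply: H.
by have := ltn_ord j; lia.
Qed.

(** Where the walk sets no record, it stays below a level already reached, so
    the count of records keeps equal to the running maximum. *)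
Lemma above_record S : sign_seqs S -> above (record S) S.
Proof.
move=> sgnS.
have maxP i : (i <= n.*2)%N ->
    (forall j, (j <= i)%N -> psum S j <= stair (record S) i) /\
    (exists2 j, (j <= i)%N & psum S j = stair (record S) i).
  elim: i => [|i IHi] le_i.
    rewrite stair0; split; last by exists 0%N; rewrite ?psum0.
    by move=> j le_j; (have -> : (j = 0)%N by lia); rewrite psum0.
  have [le_m [j0 le_j0 j0E]] := IHi (ltnW le_i); set o := Ordinal le_i.
  have mE := stairS (record S) o; rewrite /= in mE.
  have stp := psum_le_step sgnS le_i; have le_im := le_m i (leqnn i).
  case: (boolP (record S o)) mE => [/recordP/= reco|/forallPn[j nlt]] mE.
    have := reco _ le_j0 => lt_j0; split; last by exists i.+1 => //; lia.
    move=> j le_j; have [->|le_ji] : j = i.+1 \/ (j <= i)%N by lia.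
      by lia.
    by have := le_m j le_ji; lia.
  move: nlt; rewrite negb_imply => /andP[/= le_ji nlt]; have lej := le_m j le_ji.
  split; last by exists j0; [lia|lia].
  move=> j' le_j; have [->|le_ji'] : j' = i.+1 \/ (j' <= i)%N by lia.
    by move: nlt; rewrite -leNgt; lia.
  by have := le_m j' le_ji'; lia.
split=> [i reci|i le_i]; last by have [le_m _] := maxP i le_i; exact: le_m.
have [le_m [j le_ji jE]] := maxP i (ltnW (ltn_ord i)).
have lt_j := elimT (recordP S i) reci j le_ji.
have le_i := le_m i (leqnn _); have := psumS S i.
by case: (sgnS i) => ->; lia.
Qed.

(** A staircase above a walk is attained: it rises only together with the walk.
    So a record, which exceeds every earlier value of the staircase, makes it
    rise. *)
Lemma above_unique D S : above D S -> record S =1 D.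
Proof.
move=> [clD leD] i; have lt_i := ltn_ord i.
apply/recordP/idP => [reci|Di j le_ji]; last first.
  have [Si xi] := clD i Di; have := leD j; have := @stair_le D j i.
  by rewrite psumS; lia.
apply/negPn/negP => nDi.
have reached k : (k <= n.*2)%N -> exists2 j, (j <= k)%N & psum S j = stair D k.
  elim: k => [|k IHk] le_k; first by exists 0%N; rewrite ?psum0 ?stair0.
  have [j le_jk jE] := IHk (ltnW le_k); set o := Ordinal le_k.
  have mE := stairS D o; rewrite /= in mE.
  case: (boolP (D o)) mE => [Do|_] mE; last by exists j; lia.
  have [So xo] := clD o Do; rewrite /= in xo.
  by exists k.+1 => //; rewrite (psumS S o) /= So; lia.
have [j le_ji jE] := reached i (ltnW lt_i).
have := reci j le_ji; have := leD i.+1 lt_i; have := stairS D i.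
by rewrite (negPf nDi); lia.
Qed.

(** Going forward in time, the count of departures keeps equal to the least
    later height cut off at [T], half the total.  It ends at [T] and not at the
    final height because the latter is [2 T], larger than [T]. *)
Lemma below_departure P : (0 < n)%N -> positive_seqs n P -> below (departure P) P.
Proof.
move=> n_gt0 [sgnP posP]; have totE := half_totalE sgnP.
set T := half_total P in totE.
have T_gt0 : 0 < T by have := posP n.*2; rewrite -/(total P); lia.
have minP i : (i <= n.*2)%N ->
    [/\ stair (departure P) i <= T,
        forall j, (i <= j <= n.*2)%N -> stair (departure P) i <= psum P j &
        stair (departure P) i = T \/
        exists2 j, (i <= j <= n.*2)%N & psum P j = stair (departure P) i].
  elim: i => [|i IHi] le_i.
    rewrite stair0; split; [lia | | by right; exists 0%N; rewrite ?psum0].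
    by case=> [|j] le_j; rewrite ?psum0 //; have := posP j.+1; lia.
  have [le_mT le_m attained] := IHi (ltnW le_i); set o := Ordinal le_i.
  have mE := stairS (departure P) o; rewrite /= in mE.
  have stp := psum_le_step sgnP le_i; have := le_m i => le_mi.
  case: (boolP (departure P o)) mE => [/departureP/= [lt_T depo]|ndep] mE.
    have mi : psum P i = stair (departure P) i.
      case: attained => [|[j le_ij jE]]; first by lia.
      have [eq_ij|lt_ij] : j = i \/ (i < j <= n.*2)%N by lia.
        by rewrite -eq_ij jE eq_ij.
      by have := depo j lt_ij; lia.
    split; first by lia.
      by move=> j le_j; have := depo j; lia.
    by right; exists i.+1; [lia | have := depo i.+1; lia].
  have mE' : stair (departure P) i.+1 = stair (departure P) i by lia.
  rewrite mE'; split=> //; first by move=> j le_j; apply: le_m; lia.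
  case: attained => [|[j le_ij jE]]; first by left.
  have [eq_ij|lt_ij] : j = i \/ (i < j <= n.*2)%N by lia.
    case/nandP: ndep => /= [|/forallPn[j']].
      by rewrite -leNgt -{1}eq_ij jE; lia.
    rewrite negb_imply -leNgt => /andP[/= le_ij' le_x].
    have lt_j' := ltn_ord j'; have := le_m j'.+1; right; exists j'.+1; first lia.
    by rewrite -eq_ij jE in le_x; lia.
  by right; exists j; lia.
split=> [i depi|i le_i|].
- have lt_i := ltn_ord i; have [le_mT le_m attained] := minP i (ltnW lt_i).
  have [lt_T lt_x] := elimT (departureP P i) depi.
  split; first by have := lt_x i.+1; have := psumS P i; case: (sgnP i) => ->; lia.
  have := le_m i; case: attained => [|[j le_ij jE]]; first by lia.
  have [eq_ij|lt_ij] : j = i \/ (i < j <= n.*2)%N by lia.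
    by move: jE; rewrite eq_ij.
  by have := lt_x j lt_ij; lia.
- by have [_ le_m _] := minP i le_i; apply: le_m; lia.
have [le_mT _ attained] := minP _ (leqnn n.*2).
case: attained => [->//|[j le_j jE]].
by move: totE; rewrite /total; (have -> : n.*2 = j by lia); lia.
Qed.

(** Seen backwards in time, the staircase is attained again: each of its values
    is either final or the height of the walk just before the next rise. *)
Lemma below_unique D S : below D S -> departure S =1 D.
Proof.
move=> [clD leD totE] i; have lt_i := ltn_ord i.
apply/departureP/idP => [[lt_T lt_x]|Di]; last first.
  have [Si xi] := clD i Di; have mE := stairS D i; rewrite Di in mE.
  split; first by have := @stair_le D i.+1 n.*2; lia.
  by move=> j lt_ij; have := leD j; have := @stair_le D i.+1 j; lia.
apply/negPn/negP => nDi.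
have reached k : (k <= n.*2)%N -> stair D (n.*2 - k)%N = stair D n.*2 \/
    exists2 j, (n.*2 - k <= j <= n.*2)%N & psum S j = stair D (n.*2 - k)%N.
  elim: k => [|k IHk] le_k; first by left; rewrite subn0.
  have lt_o : (n.*2 - k.+1 < n.*2)%N by lia.
  set o := Ordinal lt_o; have := IHk (ltnW le_k); have := stairS D o.
  have -> : (o.+1 = n.*2 - k)%N by rewrite /o /=; lia.
  case: (boolP (D o)) => [Do _ _|_ ->].
    by right; exists o; rewrite /=; [lia | case: (clD o Do)].
  rewrite addr0 => -[|[j le_j jE]]; first by left.
  by right; exists j => //; lia.
have := stairS D i; rewrite (negPf nDi) addr0 => mE.
have le_i := leD i (ltnW lt_i); have := reached _ (leq_subr i.+1 n.*2).
rewrite subKn // mE => -[|[j le_j jE]]; first by lia.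
by have := lt_x j le_j; lia.
Qed.

(** * Reflection in a staircase *)

Definition flip D S : intseq n := [ffun i => if D i then S i else - S i].

Lemma eq_flip D D' S : D =1 D' -> flip D S = flip D' S.
Proof. by move=> eqD; apply/ffunP => i; rewrite !ffunE eqD. Qed.

Lemma flipK D : involutive (flip D).
Proof. by move=> S; apply/ffunP => i; rewrite !ffunE; case: (D i); rewrite ?opprK. Qed.

Lemma sign_flip D S : sign_seqs S -> sign_seqs (flip D S).
Proof.
move=> sgnS i; rewrite ffunE.
by case: (D i) => //; case: (sgnS i) => ->; [right; rewrite opprK | left].
Qed.

Lemma psum_flip D S i : climbs D S -> psum (flip D S) i = 2 * stair D i - psum S i.
Proof.
move=> clD; rewrite /stair /psum mulr_sumr -sumrB; apply: eq_bigr => j _.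
rewrite !ffunE; case: (boolP (D j)) => [Dj|_]; last by lia.
by have [-> _] := clD j Dj.
Qed.

Lemma climbs_flip D S : climbs D S -> climbs D (flip D S).
Proof.
move=> clD i Di; have [Si xi] := clD i Di.
by rewrite psum_flip // ffunE Di; lia.
Qed.

Lemma below_flip D S : total S = 0 -> above D S -> below D (flip D S).
Proof.
move=> tot0 [clD leD]; split; first exact: climbs_flip.
  by move=> i le_i; rewrite psum_flip //; have := leD i le_i; lia.
by rewrite /total psum_flip // -/(total S) tot0 subr0.
Qed.

Lemma above_flip D S : below D S -> above D (flip D S) /\ total (flip D S) = 0.
Proof.
move=> [clD leD totE]; split; last by rewrite /total psum_flip // -/(total S); lia.
split; first exact: climbs_flip.
by move=> i le_i; rewrite psum_flip //; have := leD i le_i; lia.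
Qed.

(** * Peaks are records and pivots are departures *)

Lemma peakE S k a : (1 <= a <= n.*2)%N -> psum S a = k%:Z ->
  (forall i, (1 <= i <= n.*2)%N -> psum S i = k%:Z -> (a <= i)%N) ->
  peak S k = a.
Proof.
move=> le_a aE min_a; apply/eqP; rewrite eqn_leq; apply/andP; split; rewrite /peak.
  have := @ge_bigmin_seq _ nat _ (index_iota 1 n.*2.+1) n.*2 a
    (fun i => psum S i == k%:Z) id.
  by rewrite mem_index_iota ltnS aE eqxx minEnat leEnat; apply.
rewrite big_seq_cond; apply: (@big_ind _ (fun x => a <= x)%N); first by lia.
  by move=> x y; lia.
by move=> i; rewrite mem_index_iota => /andP[le_i /eqP iE]; apply: min_a => //; lia.
Qed.

Lemma le_max_psumP S k : (0 < n)%N ->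
  reflect (exists2 i, (1 <= i <= n.*2)%N & k <= psum S i) (k <= max_psum S).
Proof.
move=> n_gt0; apply: (iffP idP) => [|[i le_i]]; last first.
  move=> /le_trans; apply.
  have := @le_bigmax_seq _ int _ (index_iota 1 n.*2.+1) (psum S 1) i predT (psum S).
  by rewrite mem_index_iota ltnS; apply.
suff [i le_i ->] : exists2 i, (1 <= i <= n.*2)%N & max_psum S = psum S i by exists i.
rewrite /max_psum big_seq.
apply: (@big_ind _ (fun x => exists2 i, (1 <= i <= n.*2)%N & x = psum S i)).
- by exists 1%N; first lia.
- by move=> x y Ex Ey; case: (leP x y).
- by move=> i; rewrite mem_index_iota ltnS; exists i.
Qed.

(** No level is jumped over on the way up from 0, so before the first visit to
    level [k] the walk is lower than [k]. *)
Lemma peaksE S (i : 'I_(n.*2)) : (0 < n)%N -> sign_seqs S ->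
  (i.+1 \in peaks S) = record S i.
Proof.
move=> n_gt0 sgnS; have lt_i := ltn_ord i.
apply/mapP/recordP => [[k]|reci].
  rewrite mem_filter mem_iota => /andP[/le_max_psumP[] // b le_b le_k k_range].
  have [|||j0 j0_range j0E] := @psum_hits S 0 b k%:Z; rewrite ?psum0 //; try lia.
  have hit : exists j, (j <= n.*2)%N && (psum S j == k%:Z).
    by exists j0; rewrite j0E eqxx andbT; lia.
  case: (ex_minnP hit) => a /andP[le_a /eqP aE] min_a.
  have a_gt0 : (0 < a)%N by case: a aE {le_a min_a} => //; rewrite psum0; lia.
  rewrite (@peakE S k a) ?a_gt0 //; last first.
    by move=> j le_j jE; apply: min_a; rewrite jE eqxx andbT; lia.
  move=> ia j le_ji; rewrite ia aE; apply: contraT; rewrite -leNgt => le_kj.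
  have [|||j' j'_range j'E] := @psum_hits S 0 j k%:Z; rewrite ?psum0 //; try lia.
  by have := min_a j'; rewrite j'E eqxx andbT; lia.
have x_gt0 : 0 < psum S i.+1 by have := reci 0%N; rewrite psum0; apply.
have x_le := psum_le sgnS lt_i.
have kE : psum S i.+1 = `|psum S i.+1|%N%:Z by lia.
exists `|psum S i.+1|%N.
  rewrite mem_filter mem_iota -kE; apply/andP; split; last by lia.
  by apply/le_max_psumP => //; exists i.+1.
symmetry; apply: peakE => // j le_j; rewrite -kE => jE.
by have := reci j; rewrite jE ltxx; case: (leqP j i) => // _ /(_ isT).
Qed.

Lemma pivotE S k a : (1 < k)%N -> (1 <= a <= n.*2)%N -> psum S a = k%:Z - 1 ->
  (forall i, (1 <= i <= n.*2)%N -> psum S i = k%:Z - 1 -> (i <= a)%N) ->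
  pivot S k = a.+1.
Proof.
move=> k_gt1 le_a aE max_a; rewrite /pivot gtn_eqF // add1n; congr _.+1.
apply/eqP; rewrite eqn_leq; apply/andP; split.
  apply/bigmax_leqP_seq => i; rewrite mem_index_iota => le_i /eqP iE.
  by apply: max_a => //; lia.
by apply: (@leq_bigmax_seq _ _ _ id); rewrite ?mem_index_iota ?aE.
Qed.

(** The walk ends at twice half its total, higher than any level that carries a
    pivot; it jumps over no level, so after the last visit to such a level it
    stays higher.  The first pivot fits this description with level 0. *)
Lemma pivotsE P (i : 'I_(n.*2)) : (0 < n)%N -> positive_seqs n P ->
  (i.+1 \in pivots P) = departure P i.
Proof.
move=> n_gt0 [sgnP posP]; have lt_i := ltn_ord i; have totE := half_totalE sgnP.
have T_gt0 : 0 < half_total P by have := posP n.*2; rewrite -/(total P); lia.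
have T_le : total P <= n.*2%:Z by apply: psum_le.
apply/mapP/departureP => [[k]|[lt_T lt_x]].
  rewrite mem_filter mem_iota => /andP[le_k k_range].
  have [->|k_gt1] : k = 1%N \/ (1 < k)%N by lia.
    rewrite /pivot eqxx => -[->]; rewrite psum0.
    by split=> [|j le_j]; [lia | apply: posP].
  have [|||j0 j0_range j0E] := @psum_hits P 0 n.*2 (k%:Z - 1);
    rewrite ?psum0 -?/(total P) //; try lia.
  have hit : exists j, (j <= n.*2)%N && (psum P j == k%:Z - 1).
    by exists j0; rewrite j0E eqxx andbT; lia.
  have bnd j : (j <= n.*2)%N && (psum P j == k%:Z - 1) -> (j <= n.*2)%N by case/andP.
  case: (ex_maxnP hit bnd) => a /andP[le_a /eqP aE] max_a.
  have a_gt0 : (0 < a)%N by case: a aE {le_a max_a} => //; rewrite psum0; lia.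
  rewrite (@pivotE P k a) ?a_gt0 //; last first.
    by move=> j le_j jE; apply: max_a; rewrite jE eqxx andbT; lia.
  move=> [->]; rewrite aE; split=> [|j le_j]; first by lia.
  apply: contraT; rewrite -leNgt => le_jk.
  have [|||j' j'_range j'E] := @psum_hits P j n.*2 (k%:Z - 1);
    rewrite -?/(total P) //; try lia.
  by have := max_a j'; rewrite j'E eqxx andbT; lia.
have x_ge0 : 0 <= psum P i.
  case: (nat_of_ord i) lt_i {lt_T lt_x} => [|j] lt_j; rewrite ?psum0 //.
  by have := posP j.+1; lia.
have kE : psum P i = `|psum P i|.+1%:Z - 1 by lia.
exists `|psum P i|.+1; first by rewrite mem_filter mem_iota; lia.
have [i0|i_gt0] : nat_of_ord i = 0%N \/ (0 < i)%N by lia.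
  by rewrite i0 psum0.
have x_gt0 : 0 < psum P i by apply: posP; lia.
symmetry; apply: pivotE => //; try lia.
move=> j le_j; rewrite -kE => jE.
by have := lt_x j; rewrite jE ltxx; case: (leqP j i) => // lt_ij; lia.
Qed.

Lemma peak_flipE B : (0 < n)%N -> balanced_pos n B -> peak_flip B = flip (record B) B.
Proof. by move=> n_gt0 [sgnB _ _]; apply/ffunP => i; rewrite !ffunE peaksE. Qed.

Lemma pivot_flipE P : (0 < n)%N -> positive_seqs n P ->
  pivot_flip P = flip (departure P) P.
Proof. by move=> n_gt0 posP; apply/ffunP => i; rewrite !ffunE pivotsE. Qed.

(** * The two maps *)

Lemma peak_flip_positive B : (0 < n)%N -> balanced_pos n B ->
  positive_seqs n (peak_flip B).
Proof.
move=> n_gt0 balB; rewrite peak_flipE //; have [sgnB tot0 B0] := balB.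
split=> [|i le_i]; first exact: sign_flip.
have [_ leD _] := below_flip tot0 (above_record sgnB).
have lt_0 : (0 < n.*2)%N by lia.
(* The first entry is a record, so the staircase has already left 0. *)
have rec0 : record B (Ordinal lt_0).
  by apply/recordP => -[|] // _; rewrite psumS B0 // psum0.
have := stairS (record B) (Ordinal lt_0); rewrite rec0 stair0 /=.
by have := leD i; have := @stair_le (record B) 1 i; lia.
Qed.

Lemma pivot_flip_balanced P : (0 < n)%N -> positive_seqs n P ->
  balanced_pos n (pivot_flip P).
Proof.
move=> n_gt0 posP; rewrite pivot_flipE //; have belP := below_departure n_gt0 posP.
have [[clD _] tot0] := above_flip belP; have [sgnP gt0P] := posP.
split=> [||i i0] //; first exact: sign_flip.
have [] // := clD i; apply/departureP; rewrite i0 psum0 mulr0.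
by split=> [|j le_j]; apply: gt0P; lia.
Qed.

Lemma peak_flipK B : (0 < n)%N -> balanced_pos n B -> pivot_flip (peak_flip B) = B.
Proof.
move=> n_gt0 balB; have posF := peak_flip_positive n_gt0 balB.
rewrite pivot_flipE //; rewrite peak_flipE // in posF *.
have [sgnB tot0 _] := balB; have belF := below_flip tot0 (above_record sgnB).
by rewrite (eq_flip _ (below_unique belF)) flipK.
Qed.

Lemma pivot_flipK P : (0 < n)%N -> positive_seqs n P -> peak_flip (pivot_flip P) = P.
Proof.
move=> n_gt0 posP; have balG := pivot_flip_balanced n_gt0 posP.
rewrite peak_flipE //; rewrite pivot_flipE // in balG *.
have [abvG _] := above_flip (below_departure n_gt0 posP).
by rewrite (eq_flip _ (above_unique abvG)) flipK.
Qed.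

End PeaksAndPivots.

Theorem theorem2 (n : nat) (hn : (1 <= n)%N) :
  [/\ set_bij (balanced_pos n) (positive_seqs n) (@peak_flip n),
      set_bij (positive_seqs n) (balanced_pos n) (@pivot_flip n),
      {in balanced_pos n, cancel (@peak_flip n) (@pivot_flip n)} &
      {in positive_seqs n, cancel (@pivot_flip n) (@peak_flip n)}].
Proof.
have fK : {in balanced_pos n, cancel (@peak_flip n) (@pivot_flip n)}.
  by move=> B /set_mem; apply: peak_flipK.
have gK : {in positive_seqs n, cancel (@pivot_flip n) (@peak_flip n)}.
  by move=> P /set_mem; apply: pivot_flipK.
have fP B : balanced_pos n B -> positive_seqs n (peak_flip B).
  exact: peak_flip_positive.
have gB P : positive_seqs n P -> balanced_pos n (pivot_flip P).
  exact: pivot_flip_balanced.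
split=> //; split=> //; try exact: can_in_inj fK; try exact: can_in_inj gK.
  by move=> P posP; exists (pivot_flip P); [exact: gB | exact: pivot_flipK].
by move=> B balB; exists (peak_flip B); [exact: fP | exact: peak_flipK].
Qed.
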